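(* Let $\frac1p+\frac1q=1$. For any $0<\epsilon<\mathrm{diam}_p^p(\underline S)\,\lambda$, Algorithm 5 (described in the context), with either the Jacobian or the MBI updating rule, finds an $\epsilon$-stationary point of the multi-block problem $\min\{\Phi(x):x_i\in S_i,\ i=1,\dots,d\}$ within $$N=\left\lceil\frac{2(\mathrm{diam}_p(\overline S)^p\,\lambda)^{q-1}(\Phi(x^1)-\Phi^* )}{\epsilon^q}\right\rceil$$ steps; that is, for every sequence $(x^k)_{k\ge1}$ generated by the algorithm there is an index $1\le k\le\max\{1,N\}$ such that $x^k$ is an $\epsilon$-stationary point.
   Context: Let $S_i\subseteq\mathbf R^{n_i}$ ($i=1,\dots,d$) be nonempty, convex and compact, $S=\prod_{i=1}^dS_i$, $x=(x_1,\dots,x_d)$ with blocks $x_i\in\mathbf R^{n_i}$. $f$ is a differentiable (possibly nonconvex) real-valued function on $\mathbf R^{n_1}\times\dots\times\mathbf R^{n_d}$, $\nabla_if$ its gradient with respect to block $x_i$, and each $h_i:\mathbf R^{n_i}\to\mathbf R$ is convex (possibly nonsmooth). $\Phi(x)=f(x_1,\dots,x_d)+\sum_{i=1}^dh_i(x_i)$ and $\Phi^*=\min_{x\in S}\Phi(x)$. $\|v\|_p=(\sum_j|v_j|^p)^{1/p}$; $\mathrm{diam}_p(\overline S)=\max_{1\le i\le d}\max_{x_i,y_i\in S_i}\|x_i-y_i\|_p$; $\mathrm{diam}_p(\underline S)=\min_{1\le i\le d}\max_{x_i,y_i\in S_i}\|x_i-y_i\|_p$; $\mathrm{diam}_p^p(\cdot)$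 is the $p$-th power of $\mathrm{diam}_p(\cdot)$. Standing assumption: $p>1$, $\lambda>0$ are such that $f(y)\le f(x)+\nabla f(x)^{\top}(y-x)+\frac{\lambda}{2}\|y-x\|_p^p$ for all $x,y\in S$. A point $x\in S$ is an $\epsilon$-stationary point of the multi-block problem if $\nabla_if(x)^{\top}(y_i-x_i)+h_i(y_i)-h_i(x_i)\ge-\epsilon$ for all $y_i\in S_i$ and all $i=1,\dots,d$. Let $L_i(x_i;z)=f(z)+\nabla_if(z)^{\top}(x_i-z_i)+h_i(x_i)$. Algorithm 5: start from $x^1\in S$. For $k=1,2,\dots$: for each $i$ choose $y_i^k\in\arg\min_{y_i\in S_i}L_i(y_i;x^k)$, let $d_i^k=y_i^k-x_i^k$, $\triangle_iL_k=L_i(x_i^k;x^k)-L_i(y_i^k;x^k)$, and choose $\alpha_{k,i}\in\arg\min_{\alpha\in[0,1]}\{\alpha\nabla_if(x^k)^{\top}d_i^k+\alpha^p\frac{\lambda}{2}\|d_i^k\|_p^p+(1-\alpha)h_i(x_i^k)+\alpha h_i(y_i^k)\}$. Jacobian rule: $x_i^{k+1}=(1-\alpha_{k,i})x_i^k+\alpha_{k,i}y_i^k$ for all $i$. MBI (maximum block improvement) rule: choose $i_0\in\arg\max_i\triangle_iL_k$, set $x_{i_0}^{k+1}=(1-\alpha_{k,i_0})x_{i_0}^k+\alpha_{k,i_0}y_{i_0}^k$ and $x_i^{k+1}=x_i^k$ for $i\ne i_0$. *)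

(* Defs.v *)
From HB Require Import structures.
From mathcomp Require Import all_boot all_order all_algebra.
From mathcomp Require Import all_classical all_reals all_analysis.

Set Implicit Arguments.
Unset Strict Implicit.
Unset Printing Implicit Defensive.

Import Order.TTheory GRing.Theory Num.Theory.
Import numFieldNormedType.Exports.

Local Open Scope classical_set_scope.
Local Open Scope ring_scope.

(* Points of R^{n_1} x ... x R^{n_d} are row vectors of size \sum_i n i; the
   block x_i is [submxrow x i].  There are d.+1 blocks, so that the maximum and
   the minimum over the blocks range over a nonempty index set. *)

Section Extrema.
Context {R : realType} {T : Type}.

Definition argmin (A : set T) (g : T -> R) : set T :=
  [set y | A y /\ forall z, A z -> g y <= g z].

Definition argmax (A : set T) (g : T -> R) : set T :=
  [set y | A y /\ forall z, A z -> g z <= g y].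

End Extrema.

Section Euclidean.
Context {R : realType}.

Definition lpnorm (p : R) (m : nat) (v : 'rV[R]_m) : R :=
  (\sum_(j < m) `|v 0 j| `^ p) `^ p^-1.

Definition dotv (m : nat) (u v : 'rV[R]_m) : R := \sum_(j < m) u 0 j * v 0 j.

Definition grad (m : nat) (f : 'rV[R]_m -> R) (x : 'rV[R]_m) : 'rV[R]_m :=
  \row_(j < m) 'D_(delta_mx 0 j) f x.

(* For nonempty compact A the supremum is attained, hence is the maximum. *)
Definition diam (p : R) (m : nat) (A : set 'rV[R]_m) : R :=
  sup [set lpnorm p (u - v) | u in A & v in A].

End Euclidean.

Section MultiBlock.
Context {R : realType} {d : nat} {n : 'I_d.+1 -> nat}.

Local Notation point := 'rV[R]_(\sum_i n i).

Implicit Types (S : forall i, set 'rV[R]_(n i)) (f : point -> R)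
  (h : forall i, 'rV[R]_(n i) -> R) (x y z : point) (p lam : R).

Definition block_prod S : set point :=
  [set x | forall i, S i (submxrow x i)].

Definition diam_max p S : R :=
  \big[Num.max/diam p (S ord0)]_(i < d.+1) diam p (S i).

Definition diam_min p S : R :=
  \big[Num.min/diam p (S ord0)]_(i < d.+1) diam p (S i).

Definition block_grad f x i : 'rV[R]_(n i) := submxrow (grad f x) i.

Definition Phi f h x : R := f x + \sum_(i < d.+1) h i (submxrow x i).

(* Under the hypotheses of the theorem Phi is continuous and the product of the
   S i is nonempty and compact, so this infimum is the minimum. *)
Definition Phi_star f h S : R := inf [set Phi f h x | x in block_prod S].

Definition descent_condition p lam S f : Prop :=
  forall x y, block_prod S x -> block_prod S y ->
    f y <= f x + dotv (grad f x) (y - x) + lam / 2 * lpnorm p (y - x) `^ p.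

Definition eps_stationary (eps : R) S f h x : Prop :=
  block_prod S x /\
  forall i (yi : 'rV[R]_(n i)), S i yi ->
    - eps <= dotv (block_grad f x i) (yi - submxrow x i)
             + h i yi - h i (submxrow x i).

Definition lin_block f h i (xi : 'rV[R]_(n i)) z : R :=
  f z + dotv (block_grad f z i) (xi - submxrow z i) + h i xi.

Definition lin_gap f h x (y : forall i, 'rV[R]_(n i)) i : R :=
  lin_block f h (submxrow x i) x - lin_block f h (y i) x.

Definition step_model p lam f h x i (yi : 'rV[R]_(n i)) (alpha : R) : R :=
  let di := yi - submxrow x i in
  alpha * dotv (block_grad f x i) di
  + alpha `^ p * (lam / 2) * lpnorm p di `^ p
  + (1 - alpha) * h i (submxrow x i) + alpha * h i yi.

Definition line_step x i (yi : 'rV[R]_(n i)) (alpha : R) : 'rV[R]_(n i) :=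
  (1 - alpha) *: submxrow x i + alpha *: yi.

Inductive update_rule := Jacobian | MBI.

Definition updates (rule : update_rule) f h x (y : forall i, 'rV[R]_(n i))
    (alpha : 'I_d.+1 -> R) (x' : point) : Prop :=
  match rule with
  | Jacobian => forall i, submxrow x' i = line_step x (y i) (alpha i)
  | MBI => exists i0, argmax setT (lin_gap f h x y) i0 /\
      submxrow x' i0 = line_step x (y i0) (alpha i0) /\
      forall i, i != i0 -> submxrow x' i = submxrow x i
  end.

Definition algorithm_step rule p lam S f h x x' : Prop :=
  exists (y : forall i, 'rV[R]_(n i)) (alpha : 'I_d.+1 -> R),
    (forall i, argmin (S i) (fun yi => lin_block f h yi x) (y i)) /\
    (forall i, argmin `[0, 1] (step_model p lam f h x (y i)) (alpha i)) /\
    updates rule f h x y alpha x'.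

(* The iterates are xs 1, xs 2, ...; the value xs 0 is irrelevant. *)
Definition generated rule p lam S f h (xs : nat -> point) : Prop :=
  block_prod S (xs 1%N) /\
  forall k, (1 <= k)%N -> algorithm_step rule p lam S f h (xs k) (xs k.+1).

End MultiBlock.

(* Main.v *)
Require Import Defs.
From HB Require Import structures.
From mathcomp Require Import all_boot all_order all_algebra.
From mathcomp Require Import all_classical all_reals all_analysis.
From mathcomp Require Import ring lra.

Set Implicit Arguments.
Unset Strict Implicit.
Unset Printing Implicit Defensive.

Import Order.TTheory GRing.Theory Num.Theory.
Import numFieldNormedType.Exports.

Local Open Scope classical_set_scope.
Local Open Scope ring_scope.

(** The objective decreases by a fixed amount at every step that starts from a
    point which is not eps-stationary, and it is bounded below, so there are few
    such steps.

    Decrease.  Since the p-th power of the p-norm is a sum over coordinates, the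
    descent condition on f splits over the blocks.  With the convexity of the
    h i it bounds the change of Phi along a step with block sizes beta i by the
    sum of step_model (beta i) - h i (x_i), where
      step_model alpha - h i (x_i)
        = - alpha gap_i + alpha^p (lam / 2) |y_i - x_i|^p
    with gap_i the value of lin_gap (Phi_line_step_le, step_modelE).
    Each term is nonpositive, because alpha = 0 is a competitor in the line
    search.  If x is not eps-stationary then some gap_i exceeds eps.  Write
    C = diam_max^p lam.  The competitor
    alpha = (eps / C)^(q - 1), which lies in [0, 1] because eps < C, satisfies
    alpha^p = alpha eps / C, as (q - 1) p = q, so that this block alone makes Phi
    drop by more than
      delta = alpha eps / 2 = eps^q / (2 C^(q - 1))
    (line_search_gain).  Both rules move a block whose gap is at least as large
    as gap_i: the Jacobian rule moves block i itself, the MBI rule the block of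
    largest gap (updates_line_step).  Hence algorithm_step_decrease.

    Lower bound.  For Phi_star to be below Phi on the product set, the infimum
    must be taken over a set with a lower bound (Phi_star_le).  The product set
    lies in a box, on which f is bounded below by continuity.  A convex function
    is bounded above on a box, and 2 h(0) <= h(x) + h(-x) turns this into a lower
    bound (convex_box_lbound).

    Counting.  If the first M >= 1 iterates are not eps-stationary, then
    M delta < Phi(x^1) - Phi_star, which fails as soon as
    M >= (Phi(x^1) - Phi_star) / delta (index_of_uniform_decrease). *)

(** * Convex functions on boxes *)

Section Convexity.
Context {R : realType}.

Lemma convex_function_le (V : lmodType R) (g : V -> R) (t : R) (x y : V) :
  convex_function [set: V] g -> 0 <= t <= 1 ->
  g ((1 - t) *: x + t *: y) <= (1 - t) * g x + t * g y.
Proof.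
move=> cvx_g /andP[t_ge0 t_le1].
have := cvx_g (Itv01 t_ge0 t_le1) y x.
rewrite !inE => /(_ I I).
by rewrite !convRE/= /conv/= /unstable.onem addrC [X in _ <= X]addrC.
Qed.

Lemma convex_set_line (V : lmodType R) (A : set V) (t : R) (x y : V) :
  convex_set A -> 0 <= t <= 1 -> A x -> A y -> A ((1 - t) *: x + t *: y).
Proof.
move=> cvx_A /andP[t_ge0 t_le1] Ax Ay.
have := cvx_A y x (Itv01 t_ge0 t_le1).
rewrite !inE => /(_ Ay Ax).
by rewrite /conv/= /unstable.onem addrC.
Qed.

Lemma convex_le_max_segment (V : lmodType R) (g : V -> R) (e : V) (C t : R) :
  convex_function [set: V] g -> 0 < C -> - C <= t <= C ->
  g (t *: e) <= Num.max (g (- C *: e)) (g (C *: e)).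
Proof.
move=> cvx_g C_gt0 /andP[tgeC tleC]; set M := Num.max _ _.
have Mge1 : g (- C *: e) <= M by rewrite le_max lexx.
have Mge2 : g (C *: e) <= M by rewrite le_max lexx orbT.
(* t is the combination of - C and C with weight s on C. *)
pose s := (t + C) / (2 * C).
have s01 : 0 <= s <= 1.
  by rewrite divr_ge0 ?ler_pdivrMr/=; lra.
have -> : t *: e = (1 - s) *: (- C *: e) + s *: (C *: e).
  by rewrite !scalerA -scalerDl; congr (_ *: _); rewrite /s; field; lra.
apply: le_trans (convex_function_le _ _ cvx_g s01) _.
by case/andP: s01 => s0 s1; nra.
Qed.

(** Induction on the number k of coordinates allowed to be nonzero: x is the
    midpoint of twice its part without coordinate k and twice its component along
    coordinate k.  The first lies in a box of double size with one coordinate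
    fewer, the second on a segment, where convexity gives a bound by the
    endpoints. *)
Lemma convex_box_ubound (m k : nat) (g : 'rV[R]_m -> R) :
  convex_function [set: 'rV[R]_m] g -> forall B : R, 0 < B ->
  exists M : R, forall x : 'rV[R]_m, (forall j, `|x 0 j| <= B) ->
    (forall j : 'I_m, (k <= j)%N -> x 0 j = 0) -> g x <= M.
Proof.
move=> cvx_g; elim: k => [|k IHk] B B_gt0.
  exists (g 0) => x _ x0; rewrite (_ : x = 0)//.
  by apply/rowP => j; rewrite x0 ?mxE.
have B2_gt0 : 0 < 2 * B by lra.
have [M xM] := IHk _ B2_gt0.
have [km|mk] := ltnP k m; last first.
  exists M => x xB xk; apply: xM => j; last first.
    by move=> kj; have := leq_trans (ltn_ord j) (leq_trans mk kj); rewrite ltnn.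
  by apply: le_trans (xB j) _; lra.
pose jk := Ordinal km; pose e : 'rV[R]_m := delta_mx 0 jk.
pose M' := Num.max (g (- (2 * B) *: e)) (g ((2 * B) *: e)).
exists ((1 - 2^-1) * M + 2^-1 * M') => x xB xk.
have -> : x = (1 - 2^-1) *: (2 *: (x - x 0 jk *: e)) + 2^-1 *: ((2 * x 0 jk) *: e).
  by apply/rowP => j; rewrite !mxE /=; field.
have half01 : 0 <= (2^-1 : R) <= 1 by apply/andP; split; lra.
apply: le_trans (convex_function_le _ _ cvx_g half01) _.
apply: lerD.
  apply: ler_wpM2l; first lra.
  apply: xM => j.
    rewrite !mxE eqxx/=; have [->|njk] := eqVneq j jk.
      by rewrite mulr1 subrr mulr0 normr0; lra.
    by rewrite mulr0 subr0 normrM ger0_norm// ler_wpM2l.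
  move=> kj; rewrite !mxE eqxx/=; have [->|njk] := eqVneq j jk.
    by rewrite mulr1 subrr mulr0.
  rewrite xk ?mulr0 ?subrr ?mulr0// ltn_neqAle kj andbT.
  by apply: contra_neq njk => kj'; apply: val_inj.
apply: ler_wpM2l; first lra.
apply: convex_le_max_segment => //.
by have := xB jk; rewrite ler_norml => /andP[? ?]; apply/andP; split; lra.
Qed.

(** The midpoint of x and - x is 0, so an upper bound at - x is a lower bound
    at x. *)
Lemma convex_box_lbound (m : nat) (g : 'rV[R]_m -> R) (B : R) :
  convex_function [set: 'rV[R]_m] g -> 0 < B ->
  exists c : R, forall x : 'rV[R]_m, (forall j, `|x 0 j| <= B) -> c <= g x.
Proof.
move=> cvx_g B_gt0; have [M xM] := convex_box_ubound m cvx_g B_gt0.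
exists (2 * g 0 - M) => x xB.
have half01 : 0 <= (2^-1 : R) <= 1 by apply/andP; split; lra.
have := convex_function_le x (- x) cvx_g half01.
rewrite (_ : _ *: _ + _ = 0); last by apply/rowP => j; rewrite !mxE; field.
have : g (- x) <= M.
  apply: xM => j; first by rewrite mxE normrN.
  by move=> mj; have := leq_ltn_trans mj (ltn_ord j); rewrite ltnn.
lra.
Qed.

End Convexity.

(** * Compact sets and boxes *)

Section Boxes.
Context {R : realType}.

Lemma compact_in_box (m : nat) (A : set 'rV[R]_m) :
  compact A -> \forall B \near +oo, forall x, A x -> forall j, `|x 0 j| <= B.
Proof.
move=> A_compact.
have A_bounded : \forall B \near +oo, forall x, A x -> `|x| <= B.
  exact: compact_bounded A_compact.
apply: filterS A_bounded => B AB x Ax j.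
apply: le_trans (AB x Ax); rewrite /Num.norm/= mx_normrE.
exact: (le_bigmax 0 (fun ij : 'I_1 * 'I_m => `|x ij.1 ij.2|) (0, j)).
Qed.

Lemma continuous_box_lbound (m : nat) (f : 'rV[R]_m -> R) (B : R) :
  0 < B -> continuous f ->
  exists c : R, forall x : 'rV[R]_m, (forall j, `|x 0 j| <= B) -> c <= f x.
Proof.
move=> B_gt0 f_cont.
pose box := [set x : 'rV[R]_m | forall j, x ord0 j \in `[- B, B]].
have box_compact : compact box.
  have := @rV_compact R m (fun=> `[- B, B]%classic).
  by apply => j; exact: segment_compact.
have box0 : box !=set0.
  by exists 0 => j; rewrite /= mxE in_itv/=; apply/andP; split; lra.
have [c _ cmin] := compact_EVT_min box0 box_compact (continuous_subspaceT f_cont).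
exists (f c) => x xB; apply: cmin; rewrite inE => j /=.
by rewrite in_itv/= -ler_norml; exact: xB.
Qed.

End Boxes.

(** * The p-norm and diameters *)

Section LpNorm.
Context {R : realType}.

Lemma lpnorm_ge0 (p : R) (m : nat) (v : 'rV[R]_m) : 0 <= lpnorm p v.
Proof. exact: powR_ge0. Qed.

Lemma lpnorm_powR (p : R) (m : nat) (v : 'rV[R]_m) :
  p != 0 -> lpnorm p v `^ p = \sum_(j < m) `|v 0 j| `^ p.
Proof.
move=> p0; rewrite -powRrM mulVf// powRr1//.
by apply: sumr_ge0 => j _; exact: powR_ge0.
Qed.

Lemma lpnormZ_powR (p : R) (m : nat) (a : R) (v : 'rV[R]_m) :
  p != 0 -> 0 <= a -> lpnorm p (a *: v) `^ p = a `^ p * lpnorm p v `^ p.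
Proof.
move=> p0 a0; rewrite !lpnorm_powR// big_distrr/=; apply: eq_bigr => j _.
by rewrite mxE normrM ger0_norm// powRM.
Qed.

Lemma lpnorm_le_diam (p : R) (m : nat) (A : set 'rV[R]_m) (u v : 'rV[R]_m) :
  0 < p -> compact A -> A u -> A v -> lpnorm p (u - v) <= diam p A.
Proof.
move=> p_gt0 A_compact Au Av; apply: sup_ubound; last by exists u => //; exists v.
near +oo_R => B.
have AB : forall x, A x -> forall j, `|x 0 j| <= B.
  by near: B; exact: compact_in_box.
exists ((\sum_(j < m) (2 * B) `^ p) `^ p^-1) => _ [x Ax [y Ay <-]].
have sum_ge0 (F : 'I_m -> R) : (forall j, 0 <= F j) -> 0 <= \sum_j F j.
  by move=> F0; apply: sumr_ge0.
apply: ge0_ler_powR; rewrite ?nnegrE ?invr_ge0 ?(ltW p_gt0)//.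
- by apply: sum_ge0 => j; exact: powR_ge0.
- by apply: sum_ge0 => j; exact: powR_ge0.
apply: ler_sum => j _.
have xyB : `|(x - y) 0 j| <= 2 * B.
  rewrite !mxE (le_trans (ler_normB _ _))//.
  by have := AB _ Ax j; have := AB _ Ay j; lra.
by apply: ge0_ler_powR; rewrite ?nnegrE ?(ltW p_gt0)// (le_trans _ xyB).
Unshelve. all: by end_near. Qed.

Lemma diam_ge0 (p : R) (m : nat) (A : set 'rV[R]_m) :
  0 < p -> compact A -> A !=set0 -> 0 <= diam p A.
Proof.
move=> p_gt0 A_compact [x Ax].
exact: le_trans (lpnorm_ge0 p (x - x)) (lpnorm_le_diam p_gt0 A_compact Ax Ax).
Qed.

Lemma dotvZr (m : nat) (a : R) (u v : 'rV[R]_m) :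
  dotv u (a *: v) = a * dotv u v.
Proof.
by rewrite /dotv big_distrr/=; apply: eq_bigr => j _; rewrite mxE mulrCA.
Qed.

End LpNorm.

(** * Splitting the objective over blocks *)

Section Blocks.
Context {R : realType} {d : nat} {n : 'I_d.+1 -> nat}.
Local Notation point := 'rV[R]_(\sum_i n i).
Implicit Types (S : forall i, set 'rV[R]_(n i)) (f : point -> R)
  (h : forall i, 'rV[R]_(n i) -> R) (x y z : point) (p q lam eps : R).

Lemma sum_blocks (F : 'I_(\sum_i n i) -> R) :
  \sum_j F j = \sum_i \sum_(k < n i) F (tagnat.Rank i k).
Proof.
rewrite sig_big_dep/= (reindex _ tagnat.sig_bij_on)/=.
by apply: eq_bigr => j _; rewrite tagnat.sig2K.
Qed.

Lemma dotv_blocks x y :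
  dotv x y = \sum_i dotv (submxrow x i) (submxrow y i).
Proof.
rewrite /dotv sum_blocks; apply: eq_bigr => i _.
by apply: eq_bigr => k _; rewrite !mxE.
Qed.

Lemma lpnorm_blocks p x : p != 0 ->
  lpnorm p x `^ p = \sum_i lpnorm p (submxrow x i) `^ p.
Proof.
move=> p0; rewrite lpnorm_powR// sum_blocks; apply: eq_bigr => i _.
by rewrite lpnorm_powR//; apply: eq_bigr => k _; rewrite !mxE.
Qed.

Lemma block_prod_in_box S : (forall i, compact (S i)) ->
  \forall B \near +oo, forall x, block_prod S x -> forall j, `|x 0 j| <= B.
Proof.
move=> S_compact.
have S_box : \forall B \near +oo, forall i u, S i u -> forall j, `|u 0 j| <= B.
  by apply: filter_forall => i; exact: compact_in_box.
apply: filterS S_box => B SB x Sx j.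
rewrite -(tagnat.sig2K j); have := SB _ _ (Sx (tagnat.sig1 j)) (tagnat.sig2 j).
by rewrite mxE.
Qed.

(** The content is that Phi is bounded below on the product set; otherwise the
    infimum would be a default value. *)
Lemma Phi_star_le S f h x :
  (forall i, compact (S i)) -> continuous f ->
  (forall i, convex_function [set: 'rV[R]_(n i)] (h i)) ->
  block_prod S x -> Phi_star f h S <= Phi f h x.
Proof.
move=> S_compact f_cont h_convex Sx; apply: ge_inf; last by exists x.
near +oo_R => B.
have B_gt0 : 0 < B by [].
have SB : forall z, block_prod S z -> forall j, `|z 0 j| <= B.
  by near: B; exact: block_prod_in_box.
have [c fc] := continuous_box_lbound B_gt0 f_cont.
have /choice[ch hch] : forall i, exists b : R,
    forall u : 'rV[R]_(n i), (forall j, `|u 0 j| <= B) -> b <= h i u.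
  by move=> i; exact: convex_box_lbound.
exists (c + \sum_i ch i) => _ [z /SB zB <-].
apply: lerD; first exact: fc.
by apply: ler_sum => i _; apply: hch => j; rewrite mxE.
Unshelve. all: by end_near. Qed.

Lemma diam_le_diam_max p S i : diam p (S i) <= diam_max p S.
Proof. exact: le_bigmax. Qed.

Lemma diam_max_ge0 p S : 0 < p -> (forall i, compact (S i)) ->
  (forall i, S i !=set0) -> 0 <= diam_max p S.
Proof.
move=> p_gt0 S_compact S_nonempty.
by apply: le_trans (diam_le_diam_max p S ord0); exact: diam_ge0.
Qed.

Lemma diam_min_ge0 p S : 0 < p -> (forall i, compact (S i)) ->
  (forall i, S i !=set0) -> 0 <= diam_min p S.
Proof.
move=> p_gt0 S_compact S_nonempty.
by apply: le_bigmin => [|i _]; exact: diam_ge0.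
Qed.

Lemma diam_min_le_max p S : diam_min p S <= diam_max p S.
Proof. exact: le_trans (bigmin_le _ ord0 _) (diam_le_diam_max p S ord0). Qed.

Lemma lin_gapE f h x (y : forall i, 'rV[R]_(n i)) i :
  lin_gap f h x y i =
  h i (submxrow x i) - h i (y i) - dotv (block_grad f x i) (y i - submxrow x i).
Proof.
rewrite /lin_gap /lin_block subrr.
rewrite (_ : dotv _ 0 = 0); first ring.
by rewrite /dotv big1// => j _; rewrite [X in _ * X]mxE mulr0.
Qed.

Lemma step_modelE p lam f h x (y : forall i, 'rV[R]_(n i)) i alpha :
  step_model p lam f h x (y i) alpha = h i (submxrow x i)
    - alpha * lin_gap f h x y i
    + alpha `^ p * (lam / 2) * lpnorm p (y i - submxrow x i) `^ p.
Proof. by rewrite lin_gapE /step_model; ring. Qed.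

(** As y i minimises the linearised objective over S i, the gap of block i is the
    largest violation of the stationarity inequality over S i. *)
Lemma stationary_of_gap_le eps S f h x (y : forall i, 'rV[R]_(n i)) :
  block_prod S x ->
  (forall i, argmin (S i) (fun yi => lin_block f h yi x) (y i)) ->
  (forall i, lin_gap f h x y i <= eps) -> eps_stationary eps S f h x.
Proof.
move=> Sx y_min gap_le; split=> // i yi Syi.
have [_ /(_ _ Syi)] := y_min i.
by have := gap_le i; rewrite lin_gapE /lin_block; lra.
Qed.

(** The p-norm is what makes this separable: its p-th power is additive over the
    blocks and scales by beta i ^ p on block i, which gives the last term of
    step_modelE; the terms in h i come from convexity along the segment. *)
Lemma Phi_line_step_le p lam S f h x x' (y : forall i, 'rV[R]_(n i))
    (beta : 'I_d.+1 -> R) :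
  p != 0 -> descent_condition p lam S f ->
  (forall i, convex_function [set: 'rV[R]_(n i)] (h i)) ->
  block_prod S x -> block_prod S x' ->
  (forall i, 0 <= beta i <= 1) ->
  (forall i, submxrow x' i = line_step x (y i) (beta i)) ->
  Phi f h x' <= Phi f h x +
    \sum_i (step_model p lam f h x (y i) (beta i) - h i (submxrow x i)).
Proof.
move=> p0 f_descent h_convex Sx Sx' beta01 x'E.
have dE i : submxrow (x' - x) i = beta i *: (y i - submxrow x i).
  by rewrite submxrowB x'E /line_step; apply/rowP => k; rewrite !mxE; ring.
have := f_descent _ _ Sx Sx'.
rewrite dotv_blocks lpnorm_blocks// /Phi mulr_sumr.
suff : \sum_i dotv (submxrow (grad f x) i) (submxrow (x' - x) i) +
    \sum_i lam / 2 * lpnorm p (submxrow (x' - x) i) `^ p +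
    \sum_i h i (submxrow x' i) <= \sum_i h i (submxrow x i) +
    \sum_i (step_model p lam f h x (y i) (beta i) - h i (submxrow x i)) by lra.
rewrite -!big_split/=; apply: ler_sum => i _.
have /andP[b0 b1] := beta01 i.
rewrite dE dotvZr lpnormZ_powR// x'E /line_step /step_model -/(block_grad f x i).
by have := convex_function_le (submxrow x i) (y i) (h_convex i) (beta01 i); lra.
Qed.

End Blocks.

(** * Gain of one line search, and counting *)

Section Progress.
Context {R : realType}.
Implicit Types (p q lam eps C c gap : R).

Lemma conjugate_exponent p q : 1 < p -> p^-1 + q^-1 = 1 -> 1 < q /\ (q - 1) * p = q.
Proof.
move=> p_gt1 pq.
have q_neq0 : q != 0.
  apply/eqP => q0; move: pq; rewrite q0 invr0 addr0 => /(congr1 GRing.inv).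
  by rewrite invrK invr1; lra.
have pqE : q + p = p * q.
  by rewrite -[RHS]mulr1 -pq; field; rewrite q_neq0; lra.
split; last by lra.
by nra.
Qed.

(** Here gap is the gap of a block and c the p-th power of the length of its
    direction.  For c = C and gap = eps the step (eps / (C lam))^(q - 1) is,
    up to a constant factor, the maximiser of the right-hand side; it makes
    the penalty exactly half of the linear gain. *)
Lemma line_search_gain p q lam eps C c gap :
  1 < p -> p^-1 + q^-1 = 1 -> 0 < lam -> 0 < eps -> eps < C * lam ->
  c <= C -> eps < gap ->
  exists2 alpha, 0 <= alpha <= 1 &
    eps `^ q / (2 * (C * lam) `^ (q - 1)) <
    alpha * gap - alpha `^ p * (lam / 2) * c.
Proof.
move=> p_gt1 pq lam_gt0 eps_gt0 eps_lt cC gap_gt.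
have [q_gt1 qp] := conjugate_exponent p_gt1 pq.
have CL_gt0 : 0 < C * lam by lra.
pose r := eps / (C * lam).
have r_gt0 : 0 < r by exact: divr_gt0.
have r_le1 : r <= 1 by rewrite ler_pdivrMr// mul1r ltW.
have rE : eps = r * (C * lam) by rewrite /r divfK// gt_eqF.
have a_gt0 : 0 < r `^ (q - 1) by exact: powR_gt0.
exists (r `^ (q - 1)).
  rewrite (ltW a_gt0)/= -[X in _ <= X](_ : 1 `^ (q - 1) = 1); last by rewrite powR1.
  by apply: ge0_ler_powR; rewrite ?nnegrE// ?ltW// subr_gt0.
(* The exponent q - 1 is chosen so that alpha ^ p = r alpha. *)
have -> : r `^ (q - 1) `^ p = r * r `^ (q - 1).
  by rewrite -powRrM qp mulr_powRB1// ?ltW//; lra.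
have -> : eps `^ q / (2 * (C * lam) `^ (q - 1)) = r `^ (q - 1) * (eps / 2).
  rewrite -[eps `^ q]mulr_powRB1 ?(ltW eps_gt0)//; last by lra.
  rewrite [in X in _ * X / _]rE powRM ?(ltW r_gt0) ?(ltW CL_gt0)//.
  by field; rewrite gt_eqF// powR_gt0.
have rc : r * (lam * c) <= eps.
  rewrite [X in _ <= X]rE; apply: ler_wpM2l; first exact: ltW.
  by rewrite mulrC ler_wpM2r// ltW.
have -> : r `^ (q - 1) * gap - r * r `^ (q - 1) * (lam / 2) * c =
  r `^ (q - 1) * (gap - r * (lam * c) / 2) by field.
by rewrite ltr_pM2l//; lra.
Qed.

(** The strictness of the decrease matters: without it M = (u 1 - lo) / delta
    steps of size delta would be possible, and an index up to M + 1 needed. *)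
Lemma index_of_uniform_decrease (E : nat -> Prop) (u : nat -> R) (lo delta : R) :
  0 < delta -> (forall k, (1 <= k)%N -> lo <= u k) ->
  (forall k, (1 <= k)%N -> ~ E k -> u k.+1 + delta < u k) ->
  exists k, [/\ (1 <= k)%N,
    (k%:Z <= Num.max 1 (Num.ceil ((u 1%N - lo) / delta))) & E k].
Proof.
move=> delta_gt0 u_ge u_dec; set N := Num.max _ _.
apply: contrapT => /forallNP none.
have N_ge1 : 1 <= N by rewrite le_max lexx.
have NE : N = `|N|%N by rewrite gez0_abs// (le_trans ler01).
have nE k : (1 <= k)%N -> (k <= `|N|)%N -> ~ E k.
  by move=> k_ge1 kN Ek; apply: (none k); split=> //; rewrite NE lez_nat.
(* The iterates of index 1 and k.+2 are separated by k.+1 drops. *)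
have drop k : (k < `|N|)%N -> u k.+2 + k.+1%:R * delta < u 1%N.
  elim: k => [|k IHk] kN; first by rewrite mul1r; apply: u_dec => //; exact: nE.
  have := u_dec k.+2 isT (nE k.+2 isT kN); have := IHk (ltnW kN).
  by rewrite -[in X in _ -> _ -> X](natr1 k.+1); lra.
have N_gt0 : (0 < `|N|)%N by rewrite -ltz_nat -NE; exact: lt_le_trans N_ge1.
have := drop `|N|.-1; rewrite ltn_predL prednK// => /(_ N_gt0).
have := u_ge `|N|.+1 isT.
have : u 1%N - lo <= `|N|%:R * delta.
  rewrite -ler_pdivrMr//; apply: le_trans (ceil_ge _) _.
  have -> : (`|N|%:R : R) = N%:~R by rewrite [in RHS]NE.
  by rewrite ler_int le_max lexx orbT.
lra.
Qed.

End Progress.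

(** * One step of the algorithm *)

Section Algorithm.
Context {R : realType} {d : nat} {n : 'I_d.+1 -> nat}.
Local Notation point := 'rV[R]_(\sum_i n i).
Implicit Types (S : forall i, set 'rV[R]_(n i)) (f : point -> R)
  (h : forall i, 'rV[R]_(n i) -> R) (x y z : point) (p q lam eps : R).

Lemma step_model_argmin_le p lam f h x (y : forall i, 'rV[R]_(n i)) i alpha :
  p != 0 -> argmin `[0, 1] (step_model p lam f h x (y i)) alpha ->
  step_model p lam f h x (y i) alpha <= h i (submxrow x i).
Proof.
move=> p0 [_ alpha_min].
have <- : step_model p lam f h x (y i) 0 = h i (submxrow x i).
  by rewrite step_modelE powR0// !mul0r subr0 addr0.
by apply: alpha_min; rewrite /= in_itv/= lexx ler01.
Qed.

Lemma step_model_argmin_gain p q lam eps S f h x (y : forall i, 'rV[R]_(n i))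
    i alpha :
  1 < p -> p^-1 + q^-1 = 1 -> 0 < lam -> 0 < eps ->
  (forall i, compact (S i)) -> eps < diam_max p S `^ p * lam ->
  S i (submxrow x i) -> S i (y i) ->
  argmin `[0, 1] (step_model p lam f h x (y i)) alpha ->
  eps < lin_gap f h x y i ->
  step_model p lam f h x (y i) alpha +
    eps `^ q / (2 * (diam_max p S `^ p * lam) `^ (q - 1)) < h i (submxrow x i).
Proof.
move=> p_gt1 pq lam_gt0 eps_gt0 S_compact eps_lt Sx Sy [_ alpha_min] gap_gt.
have p_gt0 : 0 < p by lra.
have dD : lpnorm p (y i - submxrow x i) `^ p <= diam_max p S `^ p.
  have le_D : lpnorm p (y i - submxrow x i) <= diam_max p S.
    apply: le_trans (diam_le_diam_max p S i).
    exact: lpnorm_le_diam.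
  have := lpnorm_ge0 p (y i - submxrow x i).
  by move=> ge0; apply: ge0_ler_powR; rewrite ?nnegrE ?(ltW p_gt0) ?(le_trans ge0).
(* Comparing with the step of line_search_gain suffices, alpha being optimal. *)
have [a a01] := line_search_gain p_gt1 pq lam_gt0 eps_gt0 eps_lt dD gap_gt.
have /alpha_min : `[0, 1]%classic a by rewrite /= in_itv.
by rewrite (step_modelE p lam f h x y i a); lra.
Qed.

(** A common description of the two rules: leaving a block unchanged is a line
    step of length 0.  All that the rate needs from a rule is that some moved
    block has a gap at least as large as any given one. *)
Lemma updates_line_step rule f h x (y : forall i, 'rV[R]_(n i))
    (alpha : 'I_d.+1 -> R) x' :
  updates rule f h x y alpha x' ->
  exists beta : 'I_d.+1 -> R,
    [/\ forall i, submxrow x' i = line_step x (y i) (beta i),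
        forall i, beta i = alpha i \/ beta i = 0 &
        forall j, exists2 i, beta i = alpha i &
          lin_gap f h x y j <= lin_gap f h x y i].
Proof.
case: rule => /= [x'E|[i0 [[_ i0_max] [x'E x'_other]]]].
  by exists alpha; split=> // [i|j]; [left | exists j].
exists (fun i => if i == i0 then alpha i else 0); split=> [i|i|j].
- have [->//|ii0] := eqVneq; rewrite x'_other// /line_step.
  by rewrite subr0 scale1r scale0r addr0.
- by case: eqP => _; [left | right].
- by exists i0; [rewrite eqxx | exact: i0_max].
Qed.

Lemma algorithm_step_decrease rule p q lam eps S f h x x' :
  1 < p -> p^-1 + q^-1 = 1 -> 0 < lam -> 0 < eps ->
  (forall i, convex_set (S i)) -> (forall i, compact (S i)) ->
  (forall i, convex_function [set: 'rV[R]_(n i)] (h i)) ->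
  descent_condition p lam S f -> eps < diam_max p S `^ p * lam ->
  block_prod S x -> algorithm_step rule p lam S f h x x' ->
  block_prod S x' /\
  (~ eps_stationary eps S f h x ->
   Phi f h x' + eps `^ q / (2 * (diam_max p S `^ p * lam) `^ (q - 1)) <
   Phi f h x).
Proof.
move=> p_gt1 pq lam_gt0 eps_gt0 S_convex S_compact h_convex f_descent eps_lt Sx.
move=> [y [alpha [y_min [alpha_min x_upd]]]].
have [beta [x'E beta_alpha gap_max]] := updates_line_step x_upd.
have p0 : p != 0 by rewrite gt_eqF//; lra.
have Sy i : S i (y i) by have [] := y_min i.
have beta01 i : 0 <= beta i <= 1.
  have [->|->] := beta_alpha i; last by rewrite lexx ler01.
  by have [] := alpha_min i; rewrite /= in_itv.
have Sx' : block_prod S x'.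
  by move=> i; rewrite x'E; exact: convex_set_line.
have model_le i : step_model p lam f h x (y i) (beta i) - h i (submxrow x i) <= 0.
  rewrite subr_le0; have [->|->] := beta_alpha i.
    exact: step_model_argmin_le.
  by rewrite step_modelE powR0// !mul0r subr0 addr0.
have Phi_le := Phi_line_step_le p0 f_descent h_convex Sx Sx' beta01 x'E.
split=> // x_nstat.
have [j gap_gt] : exists j, eps < lin_gap f h x y j.
  apply: contrapT => /forallNP gap_le; apply: x_nstat.
  by apply: stationary_of_gap_le y_min _ => // i; rewrite leNgt; apply/negP.
have [i beta_i gap_ji] := gap_max j.
have := step_model_argmin_gain p_gt1 pq lam_gt0 eps_gt0 S_compact eps_lt
  (Sx i) (Sy i) (alpha_min i) (lt_le_trans gap_gt gap_ji).
rewrite -beta_i; move: Phi_le; rewrite (bigD1 i)//=.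
set rest := \sum_(k | _) _.
have : rest <= 0 by apply: sumr_le0.
lra.
Qed.

End Algorithm.

(** * Iteration complexity *)

Theorem theorem5p2 (R : realType) (d : nat) (n : 'I_d.+1 -> nat)
    (S : forall i : 'I_d.+1, set 'rV[R]_(n i))
    (f : 'rV[R]_(\sum_i n i) -> R)
    (h : forall i : 'I_d.+1, 'rV[R]_(n i) -> R)
    (p q lam eps : R)
    (S_nonempty : forall i, S i !=set0)
    (S_convex : forall i, convex_set (S i))
    (S_compact : forall i, compact (S i))
    (f_diff : forall x, differentiable f x)
    (h_convex : forall i, convex_function [set: 'rV[R]_(n i)] (h i))
    (p_gt1 : 1 < p) (lam_gt0 : 0 < lam)
    (f_descent : descent_condition p lam S f)
    (pq : p^-1 + q^-1 = 1)
    (eps_gt0 : 0 < eps) (eps_lt : eps < diam_min p S `^ p * lam)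
    (rule : update_rule) (xs : nat -> 'rV[R]_(\sum_i n i))
    (xs_gen : generated rule p lam S f h xs) :
  let N := Num.ceil
    (2 * (diam_max p S `^ p * lam) `^ (q - 1)
       * (Phi f h (xs 1%N) - Phi_star f h S) / eps `^ q) in
  exists k : nat,
    (1 <= k)%N /\ (k%:Z <= Num.max 1 N) /\ eps_stationary eps S f h (xs k).
Proof.
have p_gt0 : 0 < p by lra.
have f_cont : continuous f by move=> x; exact: differentiable_continuous.
have eps_lt_max : eps < diam_max p S `^ p * lam.
  apply: lt_le_trans eps_lt _; rewrite ler_wpM2r ?(ltW lam_gt0)//.
  apply: ge0_ler_powR; rewrite ?nnegrE ?(ltW p_gt0) ?diam_min_le_max//.
    exact: diam_min_ge0.
  exact: diam_max_ge0.
have [xs1 xs_step] := xs_gen.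
have decrease k (k_ge1 : (1 <= k)%N) (Sk : block_prod S (xs k)) :=
  algorithm_step_decrease p_gt1 pq lam_gt0 eps_gt0 S_convex S_compact h_convex
    f_descent eps_lt_max Sk (xs_step k k_ge1).
have xsS k : (1 <= k)%N -> block_prod S (xs k).
  elim: k => // -[//|k] IHk _.
  by have [] := decrease k.+1 isT (IHk isT).
set delta := eps `^ q / (2 * (diam_max p S `^ p * lam) `^ (q - 1)).
have K_gt0 : 0 < (diam_max p S `^ p * lam) `^ (q - 1).
  by apply: powR_gt0; exact: lt_trans eps_lt_max.
have epsq_gt0 : 0 < eps `^ q by exact: powR_gt0.
have delta_gt0 : 0 < delta by rewrite divr_gt0// mulr_gt0.
have [||k [k_ge1 kN k_stat]] := index_of_uniform_decrease
    (E := fun k => eps_stationary eps S f h (xs k))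
    (u := fun k => Phi f h (xs k)) (lo := Phi_star f h S) delta_gt0.
- by move=> k k_ge1; apply: Phi_star_le => //; exact: xsS.
- by move=> k k_ge1 k_nstat; have [_] := decrease k k_ge1 (xsS k k_ge1); apply.
move=> N; exists k; split=> //; split=> //; rewrite /N.
rewrite (_ : _ / eps `^ q = (Phi f h (xs 1%N) - Phi_star f h S) / delta)//.
by rewrite /delta; field; rewrite !gt_eqF.
Qed.
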